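(* Let $p$ be a prime, let $\mathbb{F}$ be a field of characteristic $p$, and let $G = H\times K$ be a finite abelian group, where $H$ is a $p$-regular group and $K$ is a $p$-group with presentation $K=\langle X\mid Y\rangle$, $X=\{x_1,\dots,x_r\}$ ($r\in\mathbb{N}$), $Y=\{x_i^{p^{r_i}},\ x_i^{-1}x_j^{-1}x_ix_j \mid 1\le i,j\le r\}$ for some $r_i\in\mathbb{N}$ ($1 \le i \le r$). Let $\sigma$ be an $\mathbb{F}$-algebra endomorphism of $\mathbb{F}G$ which is an $\mathbb{F}$-linear extension of a group endomorphism of $G$. Then the dimension of $\mathcal{D}_\sigma(\mathbb{F}G)$ over $\mathbb{F}$ is $r|G|$, and a basis is $$\mathcal{B}=\{gD_i\mid g\in G,\ 1\le i\le r\},$$ where for each $i\in\{1,\dots,r\}$, $D_i:\mathbb{F}G\to\mathbb{F}G$ is the $\sigma$-derivation of $\mathbb{F}G$ defined by $D_i(x_j)=\delta_{ij}$ (the Kronecker delta).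
   Context: A group is $p$-regular if no element of it has order a multiple of $p$. A $\sigma$-derivation of $\mathbb{F}G$ is an $\mathbb{F}$-linear map $D:\mathbb{F}G\to\mathbb{F}G$ with $D(\alpha\beta)=D(\alpha)\sigma(\beta)+\sigma(\alpha)D(\beta)$ for all $\alpha,\beta\in\mathbb{F}G$; $\mathcal{D}_\sigma(\mathbb{F}G)$ is the $\mathbb{F}$-vector space of all of them. Every $\sigma$-derivation of $\mathbb{F}G$ vanishes on $\mathbb{F}H$, so a $\sigma$-derivation is determined by its values on $x_1,\dots,x_r$. For $g\in G$, $gD_i$ is the map $\alpha\mapsto g\,D_i(\alpha)$. $\mathbb{N}$ denotes the positive integers. *)

(* Defs.v *)
From HB Require Import structures.
From mathcomp Require Import all_boot all_order all_algebra all_fingroup.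
From mathcomp Require Import all_solvable.

Set Implicit Arguments.
Unset Strict Implicit.
Unset Printing Implicit Defensive.

Import GroupScope GRing.Theory.
Local Open Scope ring_scope.

(* An alias of {ffun gT -> F^o}: it keeps the pointwise vector space structure *)
(* but hides the pointwise product, which is replaced by convolution.          *)
Definition group_algebra (F : fieldType) (gT : finGroupType) : predArgType :=
  {ffun gT -> F^o}.

Section GroupAlgebra.
Variables (F : fieldType) (gT : finGroupType).
Local Notation A := (group_algebra F gT).

HB.instance Definition _ := Vector.copy A {ffun gT -> F^o}.

Implicit Types (a b c : A) (x y g h : gT).

Definition gelt g : A := [ffun x => (x == g)%:R].

Definition galg_mul a b : A :=
  [ffun x => \sum_(y : gT) a y * b (y^-1 * x)%g].

Fact galg_mulA : associative galg_mul.
Proof.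
move=> a b c; apply/ffunP=> x; rewrite !ffunE.
under eq_bigr => z _ do rewrite ffunE mulr_sumr.
under [RHS]eq_bigr => y _ do rewrite ffunE mulr_suml.
rewrite [RHS]exchange_big; apply: eq_bigr => z _ /=.
rewrite [RHS](reindex_inj (mulgI z)) /=; apply: eq_bigr => w _.
by rewrite mulKg mulrA invMg mulgA.
Qed.

Fact galg_mul1r : left_id (gelt 1%g) galg_mul.
Proof.
move=> a; apply/ffunP=> x; rewrite ffunE (bigD1 1%g) //= ffunE eqxx.
rewrite mul1r invg1 mul1g big1 ?addr0 // => y /negPf ny.
by rewrite ffunE ny mul0r.
Qed.

Fact galg_mulr1 : right_id (gelt 1%g) galg_mul.
Proof.
move=> a; apply/ffunP=> x; rewrite ffunE (bigD1 x) //= ffunE mulVg eqxx.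
rewrite mulr1 big1 ?addr0 // => y ny.
by rewrite ffunE -eq_mulVg1 (negPf ny) mulr0.
Qed.

Fact galg_mulDl : left_distributive galg_mul +%R.
Proof.
move=> a b c; apply/ffunP=> x; rewrite !ffunE -big_split.
by apply: eq_bigr => y _; rewrite ffunE mulrDl.
Qed.

Fact galg_mulDr : right_distributive galg_mul +%R.
Proof.
move=> a b c; apply/ffunP=> x; rewrite !ffunE -big_split.
by apply: eq_bigr => y _; rewrite ffunE mulrDr.
Qed.

Fact galg_oner_neq0 : gelt 1%g != 0.
Proof.
by apply/eqP=> /ffunP/(_ 1%g)/eqP; rewrite !ffunE eqxx oner_eq0.
Qed.

HB.instance Definition _ := GRing.Zmodule_isNzRing.Build A
  galg_mulA galg_mul1r galg_mulr1 galg_mulDl galg_mulDr galg_oner_neq0.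

Fact galg_scalerAl (k : F) a b : k *: (a * b) = (k *: a) * b.
Proof.
apply/ffunP=> x; rewrite !ffunE scaler_sumr.
by apply: eq_bigr => y _; rewrite ffunE -mulrA.
Qed.

HB.instance Definition _ := GRing.Lmodule_isLalgebra.Build F A galg_scalerAl.

Fact galg_scalerAr (k : F) a b : k *: (a * b) = a * (k *: b).
Proof.
apply/ffunP=> x; rewrite !ffunE scaler_sumr.
by apply: eq_bigr => y _; rewrite ffunE mulrCA.
Qed.

HB.instance Definition _ := GRing.Lalgebra_isAlgebra.Build F A galg_scalerAr.

Lemma galg_mulE a b x : (a * b) x = \sum_(y : gT) a y * b (y^-1 * x)%g.
Proof. exact: ffunE. Qed.

Lemma galg_oneE : 1 = gelt 1%g.
Proof. by []. Qed.

Lemma gelt_mul g h : gelt g * gelt h = gelt (g * h)%g.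
Proof.
apply/ffunP=> x; rewrite galg_mulE (bigD1 g) //= !ffunE eqxx mul1r big1.
  by rewrite addr0 -(inj_eq (mulgI g)) mulKVg.
by move=> y /negPf ny; rewrite ffunE ny mul0r.
Qed.

Lemma galg_sum_gelt a : a = \sum_(g : gT) a g *: gelt g.
Proof.
apply/ffunP=> x; rewrite sum_ffunE (bigD1 x) //= !ffunE eqxx.
rewrite [_ *: _]mulr1 big1 ?addr0 // => y ny.
by rewrite !ffunE eq_sym (negPf ny) [_ *: _]mulr0.
Qed.

End GroupAlgebra.

Arguments gelt {F gT} g.

Section SigmaDerivations.
Variables (F : fieldType) (gT : finGroupType).
Local Notation A := (group_algebra F gT).
Variable sigma : {lrmorphism A -> A}.

Definition sigma_derivation (D : 'End(A)) : Prop :=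
  forall a b : A, D (a * b) = D a * sigma b + sigma a * D b.

Definition leibniz_defect (D : 'End(A)) (a b : A) : A :=
  D (a * b) - (D a * sigma b + sigma a * D b).

Fact leibniz_defect_linear_r D a : linear (leibniz_defect D a).
Proof.
move=> k b c; rewrite /leibniz_defect mulrDr -scalerAr !linearP mulrDr mulrDr.
by rewrite -!scalerAr addrACA -scalerDr opprD addrACA -scalerBr.
Qed.
HB.instance Definition _ D a :=
  GRing.isLinear.Build F A A *:%R (leibniz_defect D a)
    (leibniz_defect_linear_r D a).

Definition leibniz_defect_lfun (D : 'End(A)) (a : A) : 'End(A) :=
  linfun (leibniz_defect D a).

Fact leibniz_defect_linear_l D : linear (leibniz_defect_lfun D).
Proof.
move=> k a b; apply/lfunP=> c; rewrite add_lfunE scale_lfunE !lfunE /=.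
rewrite /leibniz_defect mulrDl -scalerAl !linearP mulrDl mulrDl.
by rewrite -!scalerAl addrACA -scalerDr opprD addrACA -scalerBr.
Qed.
HB.instance Definition _ D :=
  GRing.isLinear.Build F A 'End(A) *:%R (leibniz_defect_lfun D)
    (leibniz_defect_linear_l D).

Definition leibniz_defect_bilin (D : 'End(A)) : 'Hom(A, 'End(A)) :=
  linfun (leibniz_defect_lfun D).

Lemma leibniz_defect_bilinE D a b :
  leibniz_defect_bilin D a b = leibniz_defect D a b.
Proof. by rewrite [leibniz_defect_bilin D a]lfunE lfunE. Qed.

Fact leibniz_defect_linear : linear leibniz_defect_bilin.
Proof.
move=> k D E; apply/lfunP=> a; apply/lfunP=> b.
rewrite leibniz_defect_bilinE !(add_lfunE, scale_lfunE) !leibniz_defect_bilinE.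
rewrite /leibniz_defect !add_lfunE !scale_lfunE mulrDl mulrDr.
by rewrite -!scalerAl -!scalerAr addrACA -scalerDr opprD addrACA -scalerBr.
Qed.
HB.instance Definition _ :=
  GRing.isLinear.Build F 'End(A) 'Hom(A, 'End(A)) *:%R leibniz_defect_bilin
    leibniz_defect_linear.

(* The sigma-derivations form a subspace, being the kernel of the linear map *)
(* D |-> (a |-> b |-> D (a * b) - (D a * sigma b + sigma a * D b)).          *)
Definition sigma_der : {vspace 'End(A)} := lker (linfun leibniz_defect_bilin).

Lemma sigma_derP (D : 'End(A)) : reflect (sigma_derivation D) (D \in sigma_der).
Proof.
rewrite memv_ker lfunE; apply: (iffP eqP) => [D0 a b | sD] /=.
  apply/eqP; rewrite -subr_eq0 -/(leibniz_defect D a b).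
  have /lfunP/(_ a)/lfunP/(_ b) := D0.
  by rewrite leibniz_defect_bilinE !zero_lfunE => ->.
apply/lfunP=> a; apply/lfunP=> b; rewrite leibniz_defect_bilinE.
by rewrite !zero_lfunE /leibniz_defect sD subrr.
Qed.

End SigmaDerivations.

(* The map a |-> c * D a. *)
Definition lmul_lfun (F : fieldType) (gT : finGroupType)
    (c : group_algebra F gT) (D : 'End(group_algebra F gT)) :
    'End(group_algebra F gT) :=
  linfun (c \*o D).

Lemma lmul_lfunE (F : fieldType) (gT : finGroupType)
    (c : group_algebra F gT) (D : 'End(group_algebra F gT)) a :
  lmul_lfun c D a = c * D a.
Proof. exact: lfunE. Qed.

Definition p_regular (p : nat) (gT : finGroupType) (A : {set gT}) : Prop :=
  forall x, x \in A -> ~~ (p %| #[x])%N.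

Section Presentations.
Variable I : finType.

(* A word in the generators indexed by I: the letter (i, false) stands for *)
(* the i-th generator and (i, true) for its inverse.                       *)
Definition gen_word := seq (I * bool).

Definition word_inv (w : gen_word) : gen_word :=
  rev [seq (a.1, ~~ a.2) | a <- w].

(* The words representing an element of the normal closure of Y in the free *)
(* group on I; two words represent the same element of the free group when  *)
(* they differ by insertions and deletions of cancelling pairs of letters.  *)
Inductive normal_closure (Y : gen_word -> Prop) : gen_word -> Prop :=
| Ncl_rel w : Y w -> normal_closure Y w
| Ncl_one : normal_closure Y [::]
| Ncl_mul u v :
    normal_closure Y u -> normal_closure Y v -> normal_closure Y (u ++ v)
| Ncl_inv u : normal_closure Y u -> normal_closure Y (word_inv u)
| Ncl_conj u v :
    normal_closure Y u -> normal_closure Y (word_inv v ++ u ++ v)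
| Ncl_insert u v i e :
    normal_closure Y (u ++ v) ->
    normal_closure Y (u ++ [:: (i, e); (i, ~~ e)] ++ v)
| Ncl_delete u v i e :
    normal_closure Y (u ++ [:: (i, e); (i, ~~ e)] ++ v) ->
    normal_closure Y (u ++ v).

Definition word_eval (gT : finGroupType) (x : I -> gT) (w : gen_word) : gT :=
  (\prod_(a <- w) (if a.2 then (x a.1)^-1 else x a.1))%g.

(* K = < X | Y > with X the family x: the morphism from the free group on I *)
(* to K given by x is onto, and its kernel is the normal closure of Y.      *)
Definition presented_by (gT : finGroupType) (K : {group gT}) (x : I -> gT)
    (Y : gen_word -> Prop) : Prop :=
  K :=: <<[set x i | i : I]>>%g /\
  forall w, word_eval x w = 1%g <-> normal_closure Y w.

End Presentations.

(* The relators x_i ^ (p ^ e i) and x_i^-1 x_j^-1 x_i x_j. *)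
Definition abelian_p_relators (p r : nat) (e : 'I_r -> nat)
    (w : gen_word 'I_r) : Prop :=
  (exists i, w = nseq (p ^ e i)%N (i, false)) \/
  (exists i j, w = [:: (i, true); (j, true); (i, false); (j, false)]).

(* Main.v *)
Require Import Defs.
From HB Require Import structures.
From mathcomp Require Import all_boot all_order all_algebra all_fingroup.
From mathcomp Require Import all_solvable.

Set Implicit Arguments.
Unset Strict Implicit.
Unset Printing Implicit Defensive.

Import GroupScope GRing.Theory.
Local Open Scope ring_scope.

(** A sigma-derivation D is governed by its logarithmic derivative: as the
group algebra A is commutative and sigma (gelt g) is a unit, setting
c g = D g * sigma g^-1 turns the Leibniz rule on group elements into
c (g * h) = c g + c h.  Conversely every map c : G -> A that is additive in
this sense gives the sigma-derivation extending g |-> c g * sigma g linearly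
([log_deriv_additive], [additive_derivationP]).  So the problem is to
describe the homomorphisms from G to the additive group of A, which is killed
by p.

Such a homomorphism kills H, whose elements have order prime to p, and its
restriction to K is determined by its values on the generators x_i
([additive_on_group_unique]).  These values are arbitrary: sending a word to
the corresponding signed sum of prescribed values respects the relators, since
p kills A and each exponent e i is positive, hence it kills their whole normal
closure and descends to K ([additive_on_group_exists]).

Therefore D |-> (D x_1, ..., D x_r) is a linear bijection from the
sigma-derivations onto A^r, which has dimension r * #|G| ([dim_sigma_der]).
If D_i is the preimage of the i-th unit vector, a sigma-derivation E is equal
to the sum of the E(x_i) D_i, because both sides agree on the generators;
expanding E(x_i) in the basis G of A shows that the r * #|G| maps g D_i span
the space, and so they form a basis ([sigma_der_basis]). *)

(** * Signed sums along words *)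

Section Words.
Variable I : finType.
Implicit Types (u v w : gen_word I).

(** The value at w of the homomorphism from the free group to V sending the
i-th generator to f i. *)
Definition word_sum (V : zmodType) (f : I -> V) w : V :=
  \sum_(a <- w) (if a.2 then - f a.1 else f a.1).

Section WordSum.
Variables (V : zmodType) (f : I -> V).

Lemma word_sum_cat u v : word_sum f (u ++ v) = word_sum f u + word_sum f v.
Proof. exact: big_cat. Qed.

Lemma word_sum_inv w : word_sum f (word_inv w) = - word_sum f w.
Proof.
rewrite /word_sum /word_inv big_rev big_map /= -sumrN.
by apply: eq_bigr => -[i []] _ /=; rewrite ?opprK.
Qed.

Lemma word_sum_cancel i b : word_sum f [:: (i, b); (i, ~~ b)] = 0.
Proof.
by rewrite /word_sum big_cons big_seq1; case: b; rewrite /= (addNr, addrN).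
Qed.

(** The kernel of a homomorphism from the free group is a normal subgroup:
conjugation is invisible because the target is abelian. *)
Lemma word_sum_normal_closure (Y : gen_word I -> Prop) w :
  (forall y, Y y -> word_sum f y = 0) ->
  normal_closure Y w -> word_sum f w = 0.
Proof.
move=> Y0; elim=> {w} [|| u v _ u0 _ v0 | u _ u0 | u v _ u0 | u v i b _ |
    u v i b _].
- exact: Y0.
- exact: big_nil.
- by rewrite word_sum_cat u0 v0 addr0.
- by rewrite word_sum_inv u0 oppr0.
- by rewrite !word_sum_cat u0 add0r word_sum_inv addNr.
- by rewrite !word_sum_cat word_sum_cancel add0r.
- by rewrite !word_sum_cat word_sum_cancel add0r.
Qed.

End WordSum.

Section WordEval.
Variables (gT : finGroupType) (x : I -> gT).

Lemma word_eval_cat u v :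
  word_eval x (u ++ v) = (word_eval x u * word_eval x v)%g.
Proof. exact: big_cat. Qed.

Lemma word_eval_inv w : word_eval x (word_inv w) = (word_eval x w)^-1%g.
Proof.
elim: w => [|[i b] w IHw]; first by rewrite /word_eval !big_nil invg1.
rewrite /word_inv map_cons rev_cons -cats1 word_eval_cat.
rewrite -[rev _]/(word_inv w) IHw.
rewrite /word_eval !big_cons big_nil mulg1 invMg /=.
by case: b; rewrite /= ?invgK.
Qed.

(** In a finite group the products of generators, without inverses, already
fill the generated subgroup. *)
Lemma mem_gen_word_eval g :
  g \in <<[set x i | i : I]>>%g -> exists w, word_eval x w = g.
Proof.
case/gen_prodgP=> n [c cX ->]; elim: n c cX => [|n IHn] c cX.
  by exists [::]; rewrite /word_eval big_nil big_ord0.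
rewrite big_ord_recl; have [|w <-] := IHn (fun i => c (lift ord0 i)).
  by move=> i; apply: cX.
have /imsetP[i _ ->] := cX ord0.
by exists ((i, false) :: w); rewrite /word_eval big_cons.
Qed.

Lemma word_eval_mem_gen w : word_eval x w \in <<[set x i | i : I]>>%g.
Proof.
apply: group_prod => -[i b] _; have xiX: x i \in <<[set x j | j : I]>>%g.
  by apply: mem_gen; apply: imset_f.
by case: b; rewrite /= ?groupV.
Qed.

End WordEval.
End Words.

(** The power relators vanish because p divides p ^ e i, which is where
0 < e i matters; the commutators vanish in any abelian group. *)
Lemma word_sum_abelian_p_relators (V : zmodType) (p r : nat) (e : 'I_r -> nat)
    (f : 'I_r -> V) w :
  (forall v : V, v *+ p = 0) -> (forall i, (0 < e i)%N) ->
  abelian_p_relators p e w -> word_sum f w = 0.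
Proof.
move=> pV0 e_gt0 [[i ->] | [i [j ->]]].
  rewrite /word_sum big_nseq iter_addr_0.
  by rewrite -(prednK (e_gt0 i)) expnS mulrnA pV0 mul0rn.
by rewrite /word_sum !big_cons big_nil /= addr0 addrA -opprD addNr.
Qed.

(** * Homomorphisms from the group to an abelian group killed by p *)

Definition additive_on_group (gT : finGroupType) (V : zmodType)
    (c : gT -> V) : Prop :=
  forall g h, c (g * h)%g = c g + c h.

Section AdditiveMaps.
Variables (gT : finGroupType) (V : zmodType) (c : gT -> V).
Hypothesis c_add : additive_on_group c.

Lemma additive_on_group1 : c 1%g = 0.
Proof. by apply: (addrI (c 1%g)); rewrite -c_add mulg1 addr0. Qed.

Lemma additive_on_groupV g : c g^-1%g = - c g.
Proof.
by apply: (addrI (c g)); rewrite -c_add mulgV additive_on_group1 subrr.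
Qed.

Lemma additive_on_groupX g n : c (g ^+ n)%g = c g *+ n.
Proof.
elim: n => [|n IHn]; first exact: additive_on_group1.
by rewrite expgS c_add IHn mulrS.
Qed.

Lemma additive_on_group_word (I : finType) (x : I -> gT) w :
  c (word_eval x w) = word_sum (c \o x) w.
Proof.
rewrite /word_eval /word_sum (big_morph c c_add additive_on_group1).
by apply: eq_bigr => -[i []] _ //=; rewrite additive_on_groupV.
Qed.

(** The value c g is killed by p and by the order of g, which are coprime. *)
Lemma additive_on_group_p_regular p g :
  prime p -> (forall v : V, v *+ p = 0) -> ~~ (p %| #[g])%N -> c g = 0.
Proof.
move=> p_prime pV0; rewrite -prime_coprime // => /eqP co_p_g.
have cg0 : c g *+ #[g] = 0.
  by rewrite -additive_on_groupX expg_order additive_on_group1.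
have [u v Euv _] := egcdnP #[g] (prime_gt0 p_prime).
have := congr1 (GRing.natmul (c g)) Euv.
by rewrite co_p_g mulrnDr !mulrnA pV0 mulrnAC cg0 mul0rn add0r.
Qed.

End AdditiveMaps.

Section PrescribedAdditiveMaps.
Variables (p : nat) (gT : finGroupType) (H K : {group gT}).
Variables (r : nat) (x : 'I_r -> gT) (e : 'I_r -> nat) (V : zmodType).
Hypotheses (abG : abelian [set: gT]) (defG : (H \x K)%g = [set: gT]).
Hypothesis presK : presented_by K x (abelian_p_relators p e).
Hypothesis pV0 : forall v : V, v *+ p = 0.

(** Words name the elements of G modulo H; working with such a word avoids
naming the projection of G onto K. *)
Lemma word_mod_factor g : exists w, (g * (word_eval x w)^-1)%g \in H.
Proof.
have [_ defHK _ _] := dprodP defG.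
have /mulsgP[h k Hh Kk ->] : g \in (H * K)%g by rewrite defHK inE.
have [defK _] := presK; rewrite defK in Kk.
by have [w <-] := mem_gen_word_eval Kk; exists w; rewrite mulgK.
Qed.

(** Write g = h * k with h in H and k a word in the x i: both maps kill h, and
on k they are given by the same signed sum. *)
Lemma additive_on_group_unique (c c' : gT -> V) :
    prime p -> p_regular p H -> additive_on_group c -> additive_on_group c' ->
  (forall i, c (x i) = c' (x i)) -> c =1 c'.
Proof.
move=> p_prime regH c_add c'_add eq_x g; have [w Hg] := word_mod_factor g.
rewrite -(mulgKV (word_eval x w) g) c_add c'_add.
rewrite !(additive_on_group_p_regular _ p_prime pV0 (regH _ Hg)) //.
rewrite !additive_on_group_word // /word_sum; congr (_ + _).
by apply: eq_bigr => a _ /=; rewrite eq_x.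
Qed.

(** The map sends g to the signed sum along any word representing g modulo H.
Two such words differ by a word whose value lies in both H and K, so is
trivial; by the presentation this word is a consequence of the relators, and
the signed sum along it vanishes. *)
Lemma additive_on_group_exists (f : 'I_r -> V) :
    (forall i, (0 < e i)%N) ->
  exists2 c : gT -> V, additive_on_group c & forall i, c (x i) = f i.
Proof.
move=> e_gt0; pose wd g := xchoose (word_mod_factor g).
have wdP g : (g * (word_eval x (wd g))^-1)%g \in H.
  exact: xchooseP (word_mod_factor g).
have [defK kerK] := presK; have [_ _ _ tiHK] := dprodP defG.
have word_sum_H w : word_eval x w \in H -> word_sum f w = 0.
  move=> Hw; apply: (@word_sum_normal_closure _ _ _ (abelian_p_relators p e)).
    by move=> y; apply: word_sum_abelian_p_relators.
  apply/kerK/set1gP; rewrite -tiHK inE Hw /=.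
  by have := word_eval_mem_gen x w; rewrite -defK.
have wdE g w : (g * (word_eval x w)^-1)%g \in H ->
    word_sum f (wd g) = word_sum f w.
  move=> Hg; apply/eqP; rewrite -subr_eq0 -word_sum_inv -word_sum_cat.
  apply/eqP/word_sum_H; rewrite word_eval_cat word_eval_inv.
  rewrite -(mulKg g (word_eval x w)^-1%g) mulgA.
  by rewrite -[(_ * g^-1)%g]invgK invMg invgK groupM ?groupV.
exists (fun g => word_sum f (wd g)) => [g h | i].
  rewrite -word_sum_cat; apply: wdE; have /centsP cG := abG.
  rewrite word_eval_cat invMg -mulgA (mulgA h).
  by rewrite (cG (h * _)%g _ (word_eval x (wd g))^-1%g) ?inE // mulgA groupM.
rewrite (wdE _ [:: (i, false)]) /word_sum /word_eval big_seq1 //=.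
by rewrite mulgV group1.
Qed.

End PrescribedAdditiveMaps.

(** * Sigma-derivations and their logarithmic derivatives *)

Section GroupAlgebraFacts.
Variables (F : fieldType) (gT : finGroupType).
Local Notation A := (group_algebra F gT).

Lemma galg_pchar p (a : A) : p \in [pchar F] -> a *+ p = 0.
Proof. by move=> charF; rewrite -scaler_nat pcharf0 // scale0r. Qed.

Lemma galg_mulC (a b : A) : abelian [set: gT] -> a * b = b * a.
Proof.
move/centsP=> cG; apply/ffunP=> x; rewrite !galg_mulE.
(* Substitute y^-1 * x for y in the convolution sum on the left. *)
rewrite (reindex_inj invg_inj) (reindex_inj (mulgI x^-1%g)) /=.
apply: eq_bigr => y _; rewrite mulrC invgK; congr (b _ * a _).
  by rewrite (cG x^-1%g) ?inE // mulgKV.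
by rewrite invMg invgK.
Qed.

Lemma dim_galg : dim A = #|gT|.
Proof. exact: muln1. Qed.

End GroupAlgebraFacts.

Section SigmaDerivationTheory.
Variables (F : fieldType) (gT : finGroupType).
Local Notation A := (group_algebra F gT).
Variable sigma : {lrmorphism A -> A}.
Hypothesis abG : abelian [set: gT].

(** The Leibniz defect is bilinear, so it vanishes as soon as it does on pairs
of group elements. *)
Lemma sigma_derivation_gelt (D : 'End(A)) :
    (forall g h, D (gelt (g * h)%g) =
       D (gelt g) * sigma (gelt h) + sigma (gelt g) * D (gelt h)) ->
  sigma_derivation sigma D.
Proof.
move=> Dgh; apply/sigma_derP; rewrite memv_ker lfunE /=; apply/eqP.
apply/lfunP=> a; rewrite zero_lfunE [a]galg_sum_gelt linear_sum big1 // => g _.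
rewrite linearZ /=; apply/lfunP=> b; rewrite scale_lfunE zero_lfunE.
rewrite [b]galg_sum_gelt linear_sum big1 ?scaler0 // => h _.
rewrite linearZ /= leibniz_defect_bilinE /leibniz_defect gelt_mul Dgh.
by rewrite subrr scaler0.
Qed.

(** Commutativity of the group algebra is what moves c past sigma a. *)
Lemma lmul_sigma_derivation c D :
  sigma_derivation sigma D -> sigma_derivation sigma (lmul_lfun c D).
Proof.
move=> derD a b; rewrite !lmul_lfunE derD mulrDr !mulrA.
by rewrite (galg_mulC c (sigma a)).
Qed.

Lemma sigma_gelt_mulV g : sigma (gelt g) * sigma (gelt g^-1%g) = 1.
Proof. by rewrite -rmorphM gelt_mul mulgV -galg_oneE rmorph1. Qed.

Lemma sigma_gelt_Vmul g : sigma (gelt g^-1%g) * sigma (gelt g) = 1.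
Proof. by rewrite -rmorphM gelt_mul mulVg -galg_oneE rmorph1. Qed.

(** Multiplication by sigma (gelt g^-1) is division by the unit
sigma (gelt g). *)
Definition log_deriv (D : 'End(A)) (g : gT) : A :=
  D (gelt g) * sigma (gelt g^-1%g).

Lemma log_derivK D g : log_deriv D g * sigma (gelt g) = D (gelt g).
Proof. by rewrite -mulrA sigma_gelt_Vmul mulr1. Qed.

(** Divide the Leibniz rule for g * h by sigma g * sigma h. *)
Lemma log_deriv_additive D :
  sigma_derivation sigma D -> additive_on_group (log_deriv D).
Proof.
move=> derD g h; rewrite /log_deriv -gelt_mul derD.
rewrite invMg -gelt_mul rmorphM mulrDl; congr (_ + _).
  by rewrite -mulrA (mulrA (sigma (gelt h))) sigma_gelt_mulV mul1r.
rewrite galg_mulC // mulrA -(mulrA _ _ (sigma (gelt g))) sigma_gelt_Vmul mulr1.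
exact: galg_mulC.
Qed.

Section AdditiveDerivation.
Variable c : gT -> A.

Definition additive_derivation_fun (a : A) : A :=
  \sum_(g : gT) a g *: (c g * sigma (gelt g)).

Fact additive_derivation_linear : linear additive_derivation_fun.
Proof.
move=> k a b; rewrite /additive_derivation_fun scaler_sumr -big_split /=.
by apply: eq_bigr => g _; rewrite !ffunE scalerDl scalerA.
Qed.
HB.instance Definition _ :=
  GRing.isLinear.Build F A A *:%R additive_derivation_fun
    additive_derivation_linear.

Definition additive_derivation : 'End(A) := linfun additive_derivation_fun.

Lemma additive_derivationE g :
  additive_derivation (gelt g) = c g * sigma (gelt g).
Proof.
rewrite lfunE /= /additive_derivation_fun (bigD1 g) //= ffunE eqxx scale1r.
by rewrite big1 ?addr0 // => h /negPf ngh; rewrite ffunE ngh scale0r.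
Qed.

(** Multiplying c (g * h) = c g + c h by sigma g * sigma h gives the Leibniz
rule on group elements, and these span the algebra. *)
Lemma additive_derivationP :
  additive_on_group c -> sigma_derivation sigma additive_derivation.
Proof.
move=> c_add; apply: sigma_derivation_gelt => g h.
rewrite !additive_derivationE c_add -gelt_mul rmorphM mulrDl !mulrA.
by rewrite (galg_mulC (sigma (gelt g))) // -!mulrA (galg_mulC (sigma (gelt g))).
Qed.

End AdditiveDerivation.

End SigmaDerivationTheory.

(** * Evaluation at the generators, dimension and basis *)

Section GeneratorEvaluation.
Variables (F : fieldType) (gT : finGroupType) (r : nat) (x : 'I_r -> gT).
Local Notation A := (group_algebra F gT).

Definition gen_values_fun (D : 'End(A)) : {ffun 'I_r -> A} :=
  [ffun i => D (gelt (x i))].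

Fact gen_values_linear : linear gen_values_fun.
Proof.
by move=> k D E; apply/ffunP=> i; rewrite !ffunE add_lfunE scale_lfunE.
Qed.
HB.instance Definition _ :=
  GRing.isLinear.Build F 'End(A) {ffun 'I_r -> A} *:%R gen_values_fun
    gen_values_linear.

Definition gen_values : 'Hom('End(A), {ffun 'I_r -> A}) :=
  linfun gen_values_fun.

Lemma gen_valuesE D i : gen_values D i = D (gelt (x i)).
Proof. by rewrite lfunE ffunE. Qed.

End GeneratorEvaluation.

Section SigmaDerivationsOfProduct.
Variables (p : nat) (F : fieldType) (gT : finGroupType) (H K : {group gT}).
Variables (r : nat) (x : 'I_r -> gT) (e : 'I_r -> nat).
Local Notation A := (group_algebra F gT).
Variable sigma : {lrmorphism A -> A}.
Hypotheses (p_prime : prime p) (charF : p \in [pchar F]).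
Hypotheses (abG : abelian [set: gT]) (defG : (H \x K)%g = [set: gT]).
Hypotheses (regH : p_regular p H) (e_gt0 : forall i, (0 < e i)%N).
Hypothesis presK : presented_by K x (abelian_p_relators p e).

(** Derivations that agree on the generators have logarithmic derivatives that
agree there, hence everywhere; their values are recovered from these. *)
Lemma sigma_derivation_unique (D E : 'End(A)) :
    sigma_derivation sigma D -> sigma_derivation sigma E ->
  (forall i, D (gelt (x i)) = E (gelt (x i))) -> D = E.
Proof.
move=> derD derE eqDE; apply/lfunP=> a; rewrite [a]galg_sum_gelt !linear_sum.
apply: eq_bigr => g _; rewrite !linearZ /= -(log_derivK sigma D).
rewrite -(log_derivK sigma E); congr (_ *: (_ * _)).
apply: (additive_on_group_unique defG presK _ p_prime regH) => [v | | |i].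
- exact: galg_pchar.
- exact: log_deriv_additive.
- exact: log_deriv_additive.
- by rewrite /log_deriv eqDE.
Qed.

(** The additive map to integrate takes the value f i / sigma x_i at x_i, so
that multiplying it by sigma x_i restores f i. *)
Lemma sigma_derivation_exists (f : 'I_r -> A) :
  exists2 D : 'End(A), sigma_derivation sigma D
    & forall i, D (gelt (x i)) = f i.
Proof.
have pA0 (a : A) : a *+ p = 0 by apply: galg_pchar.
have [c c_add cx] := additive_on_group_exists abG defG presK pA0
  (fun i => f i * sigma (gelt (x i)^-1%g)) e_gt0.
exists (additive_derivation sigma c); first exact: additive_derivationP.
by move=> i; rewrite additive_derivationE cx -mulrA sigma_gelt_Vmul mulr1.
Qed.

(** Evaluation at the generators is injective on the sigma-derivations by
uniqueness and maps them onto A ^ r by existence. *)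
Lemma dim_sigma_der : \dim (sigma_der sigma) = (r * #|gT|)%N.
Proof.
have injEv : (sigma_der sigma :&: lker (gen_values F x))%VS = 0%VS.
  apply/eqP; rewrite -subv0; apply/subvP=> D; rewrite memv_cap memv0.
  case/andP=> /sigma_derP derD /[!memv_ker]/eqP evD; apply/eqP.
  apply: sigma_derivation_unique => // [a b | i].
    by rewrite !zero_lfunE mul0r mulr0 addr0.
  by rewrite zero_lfunE -gen_valuesE evD ffunE.
rewrite -(limg_dim_eq injEv).
have -> : (gen_values F x @: sigma_der sigma)%VS = fullv.
  apply/eqP; rewrite eqEsubv subvf; apply/subvP=> f _.
  have [D derD Dx] := sigma_derivation_exists f.
  have -> : f = gen_values F x D by apply/ffunP=> i; rewrite gen_valuesE Dx.
  by apply/memv_img/sigma_derP.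
by rewrite dimvf /dim /= card_ord dim_galg.
Qed.

Section DualFamily.
Variable D : 'I_r -> 'End(A).
Hypothesis derD : forall i, sigma_derivation sigma (D i).
Hypothesis D_dual : forall i j, D i (gelt (x j)) = (i == j)%:R.

(** Both sides are sigma-derivations, and at x j the right-hand side is the
expansion of E (gelt (x j)) in the basis of group elements. *)
Lemma sigma_derivation_sum_dual (E : 'End(A)) :
  sigma_derivation sigma E ->
  E = \sum_i \sum_g E (gelt (x i)) g *: lmul_lfun (gelt g) (D i).
Proof.
move=> derE; apply: sigma_derivation_unique => // [|j].
  apply/sigma_derP; do 2![apply: memv_suml => ? _]; apply: memvZ.
  by apply/sigma_derP; apply: lmul_sigma_derivation.
rewrite sum_lfunE (bigD1 j) //= [X in _ + X]big1 ?addr0 => [|i /negPf nij].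
  rewrite sum_lfunE [LHS]galg_sum_gelt; apply: eq_bigr => g _.
  by rewrite scale_lfunE lmul_lfunE D_dual eqxx mulr1.
rewrite sum_lfunE big1 // => g _.
by rewrite scale_lfunE lmul_lfunE D_dual nij mulr0 scaler0.
Qed.

(** A spanning family with as many members as the dimension is a basis, so
linear independence comes from the dimension count. *)
Lemma sigma_der_basis :
  basis_of (sigma_der sigma)
    [seq lmul_lfun (gelt g) (D i) | g <- enum [set: gT], i <- enum 'I_r].
Proof.
rewrite basisEdim; apply/andP; split; last first.
  by rewrite size_allpairs -!cardE cardsT card_ord dim_sigma_der mulnC.
apply/subvP=> E /sigma_derP/sigma_derivation_sum_dual->.
do 2![apply: memv_suml => ? _]; apply/memvZ/memv_span.
by apply: allpairs_f; rewrite mem_enum ?inE.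
Qed.

End DualFamily.
End SigmaDerivationsOfProduct.

Theorem theorem3p15 (p : nat) (F : fieldType) (gT : finGroupType)
    (H K : {group gT}) (r : nat) (x : 'I_r -> gT) (e : 'I_r -> nat)
    (sigma : {lrmorphism group_algebra F gT -> group_algebra F gT})
    (p_prime : prime p) (charF : p \in [pchar F])
    (abG : abelian [set: gT]) (defG : (H \x K)%g = [set: gT])
    (regH : p_regular p H) (pK : p.-group K)
    (r_gt0 : (0 < r)%N) (e_gt0 : forall i, (0 < e i)%N)
    (presK : presented_by K x (abelian_p_relators p e))
    (sigma_ext : exists phi : {morphism [set: gT] >-> gT},
       forall g : gT, sigma (gelt g) = gelt (phi g)) :
  \dim (sigma_der sigma) = (r * #|[set: gT]|)%N /\
  exists D : 'I_r -> 'End(group_algebra F gT),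
    [/\ forall i, sigma_derivation sigma (D i),
        forall i j, D i (gelt (x j)) = (i == j)%:R,
        forall i (E : 'End(group_algebra F gT)),
          sigma_derivation sigma E ->
          (forall j, E (gelt (x j)) = (i == j)%:R) -> E = D i
      & basis_of (sigma_der sigma)
          [seq lmul_lfun (gelt g) (D i) | g <- enum [set: gT], i <- enum 'I_r]].
Proof.
have derivX i := sigma_derivation_exists sigma charF abG defG e_gt0 presK
  (fun j => (i == j)%:R).
have derivX2 i : exists D : 'End(group_algebra F gT),
    sigma_derivation sigma D /\ forall j, D (gelt (x j)) = (i == j)%:R.
  by have [D derD Dx] := derivX i; exists D.
have [D D_P] := fin_all_exists derivX2.
split.
  by rewrite cardsT (dim_sigma_der sigma p_prime _ abG defG _ _ presK).
exists D; split=> [i | i j | i E derE Ex |].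
- by have [] := D_P i.
- by have [_ ->] := D_P i.
- apply: (sigma_derivation_unique p_prime charF abG defG regH presK derE).
    by have [] := D_P i.
  by move=> j; have [_ ->] := D_P i.
apply: (sigma_der_basis p_prime charF abG defG regH e_gt0 presK) => i *;
  by have [derD Dx] := D_P i.
Qed.
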